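(* Let $x^*$ be an optimal solution of $\min_{x\in X}\{\Psi(x)=f(x)+h(x)+\mu\,\omega(x)\}$, let $x^t, g^t$ be generated by the primal-dual gradient (PDG) method with parameters $\{\tau_t\},\{\eta_t\},\{\alpha_t\}$, and for weights $\theta_t\ge 0$ let $\bar x^k=(\sum_{t=1}^k\theta_t)^{-1}\sum_{t=1}^k\theta_t x^t$ and $\bar z^k=(\sum_{t=1}^k\theta_t)^{-1}\sum_{t=1}^k\theta_t (x^t,g^t)$. (a) Suppose $\mu>0$ and for all $t=1,\dots,k$ $$\tau_t=\sqrt{\tfrac{2L_f}{\mu}},\quad \eta_t=\sqrt{2L_f\mu},\quad \alpha_t=\alpha:=\frac{\sqrt{2L_f/\mu}}{1+\sqrt{2L_f/\mu}},\quad \theta_t=\frac{1}{\alpha^t}.$$ Then $$P(x^k,x^* )\le \frac{\mu+L_f}{\mu}\,\alpha^k P(x^0,x^* ),$$ $$\Psi(\bar x^k)-\Psi(x^* )\le \mathrm{gap}^*(\bar z^k)\le \mu(1-\alpha)^{-1}\Big[1+\tfrac{L_f}{\mu}\big(2+\tfrac{L_f}{\mu}\big)\Big]\alpha^k P(x^0,x^* ),$$ $$\Psi(\bar x^k)-\Psi(x^* )\le \mathrm{gap}(\bar z^k)\le \mu(1-\alpha)^{-1}\Big[1+\tfrac{L_f}{\mu}\big(2+\tfrac{L_f}{\mu}\big)\Big]\alpha^k \max_{x\in X}P(x^0,x).$$ (b) Suppose that for all $t=1,\dots,k$ $$\tau_t=\frac{t-1}{2},\quad \eta_t=\frac{4L_f}{t},\quad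 \alpha_t=\frac{t-1}{t},\quad \theta_t=t.$$ Then $$\Psi(\bar x^k)-\Psi(x^* )\le \mathrm{gap}^*(\bar z^k)\le \frac{8L_f}{k(k+1)}P(x^0,x^* ),$$ $$\Psi(\bar x^k)-\Psi(x^* )\le \mathrm{gap}(\bar z^k)\le \frac{8L_f}{k(k+1)}\max_{x\in X}P(x^0,x).$$
   Context: Problem data: $X\subseteq\mathbb{R}^n$ is closed convex; $\|\cdot\|$ is an arbitrary norm on $\mathbb{R}^n$ with conjugate norm $\|\cdot\|_*$; $f=\sum_{i=1}^m f_i$ where $f_i:\mathbb{R}^n\to\mathbb{R}$ are convex, differentiable, with $\|\nabla f_i(x_1)-\nabla f_i(x_2)\|_*\le L_i\|x_1-x_2\|$ for all $x_1,x_2$; $L=\sum_i L_i$; $L_f\ge 0$ is a constant with $\|\nabla f(x_1)-\nabla f(x_2)\|_*\le L_f\|x_1-x_2\|\le L\|x_1-x_2\|$ for all $x_1,x_2$; $h:X\to\mathbb{R}$ is convex; $\omega:X\to\mathbb{R}$ is strongly convex with modulus $1$ w.r.t. $\|\cdot\|$; $\mu\ge 0$. Primal prox-function: $P(x^0,x)=\omega(x)-[\omega(x^0)+\langle\omega'(x^0),x-x^0\rangle]$, where $\omega'(x^0)\in\partial\omega(x^0)$; it satisfies $P(x^0,x)\ge\frac12\|x-x^0\|^2$. Prox-mapping: $\mathcal{M}_X(g,x^0,\eta)=\arg\min_{x\in X}\{\langle g,x\rangle+h(x)+\mu\,\omega(x)+\eta P(x^0,x)\}$ (assumed computable, in particular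 well defined). The subgradients of $\omega$ are selected recursively: if $x^1=\mathcal{M}_X(g,x^0,\eta)$, then $\omega'(x^1)\in\partial\omega(x^1)$ is chosen so that for some $h'(x^1)\in\partial h(x^1)$, $\langle g+h'(x^1)+(\mu+\eta)\omega'(x^1)-\eta\omega'(x^0),x-x^1\rangle\ge 0$ for all $x\in X$; this $\omega'(x^1)$ is used in $P(x^1,\cdot)$. Dual objects: $J_f$ is the convex conjugate of $f$, $\mathcal{G}$ the dual space where the gradients of $f$ reside (the domain of $J_f$), so $f(x)=\max_{g\in\mathcal{G}}\langle x,g\rangle-J_f(g)$. $D_f(g^0,g)=J_f(g)-[J_f(g^0)+\langle J_f'(g^0),g-g^0\rangle]$ with $J_f'(g^0)\in\partial J_f(g^0)$. PDG method: $x^0=x^{-1}\in X$, $g^0=\nabla f(x^0)$, $\underline x^0=x^0$. For $t=1,2,\dots,k$: $\tilde x^t=\alpha_t(x^{t-1}-x^{t-2})+x^{t-1}$; $g^t=\arg\min_{g\in\mathcal{G}}\{\langle-\tilde x^t,g\rangle+J_f(g)+\tau_tD_f(g^{t-1},g)\}$; $x^t=\mathcal{M}_X(g^t,x^{t-1},\eta_t)$. The subgradient in $D_f(g^{t-1},\cdot)$ is $J_f'(g^{t-1})=\underline x^{t-1}$, so that equivalently $\underline x^t=(\tilde x^t+\tau_t\underline x^{t-1})/(1+\tau_t)$ and $g^t=\nabla f(\underline x^t)$. Gap functions: for $\bar z=(\bar x,\bar g)$, $z=(x,g)$ in $X\times\mathcal{G}$, $Q_f(\bar z,z)=[h(\bar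 x)+\mu\omega(\bar x)+\langle\bar x,g\rangle-J_f(g)]-[h(x)+\mu\omega(x)+\langle x,\bar g\rangle-J_f(\bar g)]$; $\mathrm{gap}(\bar z)=\max_{z\in X\times\mathcal{G}}Q_f(\bar z,z)$; $\mathrm{gap}^*(\bar z)=\max\{Q_f(\bar z,z): x=x^*, g\in\mathcal{G}\}$. The bounds involving $\mathrm{gap}(\bar z^k)$ and $\max_{x\in X}P(x^0,x)$ are meant for bounded $X$ (maxima read as suprema, possibly $+\infty$, otherwise). *)

(* Defs.v *)
From HB Require Import structures.
From mathcomp Require Export all_boot all_order all_algebra.
From mathcomp Require Export all_classical all_reals all_analysis.

Set Implicit Arguments.
Unset Strict Implicit.
Unset Printing Implicit Defensive.

Export Order.TTheory GRing.Theory Num.Theory.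
Export numFieldNormedType.Exports.

Local Open Scope classical_set_scope.
Local Open Scope ring_scope.

Section VectorsAndConvexity.
Context {R : realType} {n : nat}.
Implicit Types (x y v g : 'rV[R]_n) (X : set 'rV[R]_n) (f phi : 'rV[R]_n -> R).

Definition dot x y : R := \sum_(i < n) x 0 i * y 0 i.

(* An arbitrary norm on R^n. It is unrelated to the canonical norm [`|x|] of
   ['rV[R]_n] (the max norm), which only provides the topology used for
   closedness and differentiability. *)
Record is_norm (N : 'rV[R]_n -> R) : Prop := IsNorm {
  is_norm_triangle : forall x y, N (x + y) <= N x + N y;
  is_norm_scale : forall (a : R) x, N (a *: x) = `|a| * N x;
  is_norm_eq0 : forall x, N x = 0 -> x = 0 }.

(* The supremum is taken in [\bar R] so that it needs no boundedness proof. *)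
Definition dual_norm (N : 'rV[R]_n -> R) g : \bar R :=
  ereal_sup [set (dot g x)%:E | x in [set x | N x <= 1]].

Definition grad f x : 'rV[R]_n := \row_(i < n) 'D_(delta_mx 0 i) f x.

(* Functions on [X] are represented by total functions whose values outside
   [X] are never used; the subdifferential is the one of [phi] extended by +oo
   outside [X]. *)
Definition subdiff X phi x : set 'rV[R]_n :=
  [set v | forall y, X y -> phi x + dot v (y - x) <= phi y].

Definition strongly_convex X (N : 'rV[R]_n -> R) (nu : R) phi : Prop :=
  forall x y (l : R), X x -> X y -> 0 <= l <= 1 ->
    phi (l *: x + (1 - l) *: y) <=
    l * phi x + (1 - l) * phi y - nu / 2 * (l * (1 - l) * N (x - y) ^+ 2).

Definition argmin X phi : set 'rV[R]_n :=
  [set x | X x /\ forall y, X y -> phi x <= phi y].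

(* Distance generated by [phi], with [v] in the role of the selected
   subgradient of [phi] at [y]. *)
Definition bregman phi v y z : R := phi z - (phi y + dot v (z - y)).

Definition conjugate f g : \bar R := ereal_sup (range (fun x => (dot x g - f x)%:E)).

Definition dual_dom f : set 'rV[R]_n := [set g | (conjugate f g < +oo)%E].

(* [conjugate f] never takes the value -oo, so on [dual_dom f] it is finite and
   [fine] loses nothing; [conj_fun f] is only used on [dual_dom f]. *)
Definition conj_fun f g : R := fine (conjugate f g).

End VectorsAndConvexity.

Section PrimalDualGradient.
Context {R : realType} {n : nat}.
Variables (X : set 'rV[R]_n) (f h omega : 'rV[R]_n -> R) (mu : R).
Implicit Types (x g v : 'rV[R]_n) (z : 'rV[R]_n * 'rV[R]_n).

Definition composite x : R := f x + h x + mu * omega x.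

(* The primal prox-function P(x0, -) is [bregman omega w0 x0], where [w0] is
   the selected subgradient of [omega] at [x0]. *)
Definition prox_map g w0 x0 (eta : R) : set 'rV[R]_n :=
  argmin X (fun x => dot g x + h x + mu * omega x + eta * bregman omega w0 x0 x).

Definition dual_prox_map xt v0 g0 (tau : R) : set 'rV[R]_n :=
  argmin (dual_dom f) (fun g =>
    dot (- xt) g + conj_fun f g + tau * bregman (conj_fun f) v0 g0 g).

(* Iterates of the method up to step [k]: [x t], [g t] are the primal and dual
   iterates, [w t] the selected subgradient of [omega] at [x t], and [u t] the
   selected subgradient of the conjugate of [f] at [g t]. For [t = 1] the
   truncated index [t.-2] is 0, which encodes the convention x^{-1} = x^0. *)
Record pdg_run (k : nat) (tau eta alpha : nat -> R)
    (x g w u : nat -> 'rV[R]_n) : Prop := PdgRun {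
  pdg_x0 : X (x 0%N);
  pdg_w0 : subdiff X omega (x 0%N) (w 0%N);
  pdg_g0 : g 0%N = grad f (x 0%N);
  pdg_u0 : u 0%N = x 0%N;
  pdg_step : forall t : nat, (1 <= t <= k)%N ->
    let xt := alpha t *: (x t.-1 - x t.-2) + x t.-1 in
    [/\ g t \in dual_prox_map xt (u t.-1) (g t.-1) (tau t),
        u t = (1 + tau t)^-1 *: (xt + tau t *: u t.-1),
        x t \in prox_map (g t) (w t.-1) (x t.-1) (eta t),
        subdiff X omega (x t) (w t) &
        exists2 h', subdiff X h (x t) h' &
          forall y, X y ->
            0 <= dot (g t + h' + (mu + eta t) *: w t - eta t *: w t.-1)
                     (y - x t)] }.

Definition gap_fun (zbar z : 'rV[R]_n * 'rV[R]_n) : R :=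
  (h zbar.1 + mu * omega zbar.1 + dot zbar.1 z.2 - conj_fun f z.2)
  - (h z.1 + mu * omega z.1 + dot z.1 zbar.2 - conj_fun f zbar.2).

Definition gap zbar : \bar R :=
  ereal_sup [set (gap_fun zbar z)%:E | z in X `*` dual_dom f].

Definition gap_star (xs : 'rV[R]_n) zbar : \bar R :=
  ereal_sup [set (gap_fun zbar (xs, g))%:E | g in dual_dom f].

End PrimalDualGradient.

Definition weighted_avg {R : realType} {n : nat} (k : nat) (theta : nat -> R)
    (y : nat -> 'rV[R]_n) : 'rV[R]_n :=
  (\sum_(1 <= t < k.+1) theta t)^-1 *: \sum_(1 <= t < k.+1) theta t *: y t.

(* Main.v *)
Require Import Defs.
From mathcomp Require Import ring lra.

Set Implicit Arguments.
Unset Strict Implicit.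
Unset Printing Implicit Defensive.

Local Open Scope classical_set_scope.
Local Open Scope ring_scope.

(** Write [D_t = x^t - x^(t-1)], [P_t] and [D(t, .)] for the primal and dual
    Bregman distances based at the [t]-th iterates.  The primal optimality
    condition and the identity [(1 + tau_t) u^t = xt^t + tau_t u^(t-1)] bound the
    one-step gap, so that the potential
      [Phi_t = (mu + eta_t) P_t(x) + (1 + tau_t) D(t, g) - <D_t, g - g^t>
               + eta_t P_(t-1)(x^t)]
    satisfies [Q_t + Phi_t <= alpha_t Phi_(t-1)].  The extrapolation term is
    absorbed because [L_f]-smoothness of [f] gives
      [D(t, g) >= <g - g^t, d> - (L_f / 2) N(d)^2]   for every [d],
    which replaces strong convexity of the conjugate and is used with
    [d = D_t / (1 + tau_t)]; this needs only [L_f <= eta_t (1 + tau_t)].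

    The potential then telescopes.  In case (b) [tau_1 = 0], so the initial dual
    distance disappears.  In case (a) the supremum over [g] in the gap is
    attained at [grad f xbar], and [D(0, grad f xbar) <= (L_f / 2) N(x^0 - xbar)^2]
    is controlled by [P_0] itself, or, for the gap at [xs], by the linear
    convergence of the iterates, obtained from the same potential at the saddle
    point [(xs, grad f xs)]. *)

(** * Bilinearity of the pairing *)

Section Dot.
Context {R : realType} {n : nat}.
Implicit Types (x y z v : 'rV[R]_n) (a : R).

Lemma dotC x y : dot x y = dot y x.
Proof. by apply: eq_bigr => i _; rewrite mulrC. Qed.

Lemma dotDl x y z : dot (x + y) z = dot x z + dot y z.
Proof. by rewrite -big_split; apply: eq_bigr => i _; rewrite mxE mulrDl. Qed.

Lemma dotZl a x y : dot (a *: x) y = a * dot x y.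
Proof. by rewrite mulr_sumr; apply: eq_bigr => i _; rewrite mxE mulrA. Qed.

Lemma dotNl x y : dot (- x) y = - dot x y.
Proof. by rewrite -scaleN1r dotZl mulN1r. Qed.

Lemma dot0l x : dot 0 x = 0.
Proof. by rewrite -(scale0r 0) dotZl mul0r. Qed.

Lemma dotDr x y z : dot x (y + z) = dot x y + dot x z.
Proof. by rewrite dotC dotDl !(dotC _ x). Qed.

Lemma dotZr a x y : dot x (a *: y) = a * dot x y.
Proof. by rewrite dotC dotZl dotC. Qed.

Lemma dotNr x y : dot x (- y) = - dot x y.
Proof. by rewrite dotC dotNl dotC. Qed.

Definition dotE := (dotDl, dotDr, dotNl, dotNr, dotZl, dotZr).

Lemma dot_sumr (I : Type) (r : seq I) x (F : I -> 'rV[R]_n) :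
  dot x (\sum_(i <- r) F i) = \sum_(i <- r) dot x (F i).
Proof.
elim: r => [|i r IH]; first by rewrite !big_nil dotC dot0l.
by rewrite !big_cons dotDr IH.
Qed.

End Dot.

(** Division by [l] and [l] tending to 0, made elementary. It turns inequalities along a segment,
    with a second-order error, into first-order conditions. *)
Lemma ge0_of_quadratic (R : realType) (a c : R) :
  (forall l, 0 < l <= 1 -> 0 <= l * a + l ^+ 2 * c) -> 0 <= a.
Proof.
move=> H; rewrite leNgt; apply/negP => a0.
have c0 : 0 <= `|c| by [].
have cc : c <= `|c| by exact: ler_norm.
(* If [a < 0], the test value [- a / d] lies in ]0, 1] and is small enough that its product with
   [|c|] stays below [- a]. *)
set d := 1 + `|c| - a.
have d0 : 0 < d by rewrite /d; lra.
have l0 : 0 < - a / d by rewrite divr_gt0// oppr_gt0.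
have l1 : - a / d <= 1 by rewrite ler_pdivrMr// /d; lra.
have := H (- a / d); rewrite l0 l1 => /(_ isT).
rewrite expr2 -mulrA -mulrDr pmulr_rge0// => H1.
have : - a / d * c <= - a / d * `|c| by rewrite ler_wpM2l// ltW.
have : - a / d * `|c| < - a.
  by rewrite mulrAC ltr_pdivrMr// ltr_pM2l ?oppr_gt0// /d; lra.
lra.
Qed.

(** * Arbitrary norms and their dual norms *)

Section Norm.
Context {R : realType} {n : nat} (N : 'rV[R]_n -> R) (N_norm : is_norm N).
Implicit Types (x y v g : 'rV[R]_n).

Lemma is_normN x : N (- x) = N x.
Proof. by rewrite -scaleN1r is_norm_scale// normrN1 mul1r. Qed.

Lemma is_norm0 : N 0 = 0.
Proof. by rewrite -(scale0r 0) is_norm_scale// normr0 mul0r. Qed.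

Lemma is_norm_ge0 x : 0 <= N x.
Proof.
have := is_norm_triangle N_norm x (- x).
by rewrite subrr is_norm0 is_normN; lra.
Qed.

Lemma is_norm_dist x y : N (x - y) = N (y - x).
Proof. by rewrite -is_normN opprB. Qed.

Lemma dual_norm_dot g c v : (dual_norm N g <= c%:E)%E -> dot g v <= c * N v.
Proof.
move=> gc; have [Nv0|Nv0] := eqVneq (N v) 0.
  have -> : v = 0 by exact: is_norm_eq0 Nv0.
  by rewrite dotC dot0l is_norm0 mulr0.
have Nv : 0 < N v by rewrite lt_neqAle eq_sym Nv0 is_norm_ge0.
have : ((dot g ((N v)^-1 *: v))%:E <= c%:E)%E.
  apply: le_trans gc; apply: ereal_sup_ubound; exists ((N v)^-1 *: v) => //=.
  by rewrite is_norm_scale// ger0_norm ?invr_ge0 ?is_norm_ge0// mulVf.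
by rewrite lee_fin dotZr mulrC ler_pdivrMr.
Qed.

End Norm.

(** * Jensen's inequality for weighted averages *)

Section Jensen.
Context {R : realType} {n : nat}.
Variables (X : set 'rV[R]_n) (F : 'rV[R]_n -> R).
Hypothesis X_conv : forall x y l, X x -> X y -> 0 <= l <= 1 ->
  X (l *: x + (1 - l) *: y).
Hypothesis F_conv : forall x y l, X x -> X y -> 0 <= l <= 1 ->
  F (l *: x + (1 - l) *: y) <= l * F x + (1 - l) * F y.

(** Each new average is a convex combination of the previous one and the new point. Membership in
    [X] is carried along because convexity of [F] is known only there. *)
Lemma jensen_weighted_avg (k : nat) (theta : nat -> R) (y : nat -> 'rV[R]_n) :
  (forall t, (1 <= t <= k)%N -> 0 <= theta t) ->
  (forall t, (1 <= t <= k)%N -> X (y t)) ->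
  0 < \sum_(1 <= t < k.+1) theta t ->
  X (weighted_avg k theta y) /\
  (\sum_(1 <= t < k.+1) theta t) * F (weighted_avg k theta y)
    <= \sum_(1 <= t < k.+1) theta t * F (y t).
Proof.
elim: k => [|k IH] th0 Xy; first by rewrite big_geq// ltxx.
have th0' t : (1 <= t <= k)%N -> 0 <= theta t.
  by move=> /andP[t1 tk]; apply: th0; rewrite t1 (leq_trans tk).
have Xy' t : (1 <= t <= k)%N -> X (y t).
  by move=> /andP[t1 tk]; apply: Xy; rewrite t1 (leq_trans tk).
have XS : X (y k.+1) by apply: Xy; rewrite leqnn.
have thS : 0 <= theta k.+1 by apply: th0; rewrite leqnn.
have S0 : 0 <= \sum_(1 <= t < k.+1) theta t.
  by rewrite big_nat; apply: sumr_ge0 => t; rewrite ltnS; exact: th0'.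
rewrite /weighted_avg !(big_nat_recr k.+1)//=.
move: IH => /(_ th0' Xy'); rewrite /weighted_avg.
set S := \sum_(1 <= t < k.+1) theta t in S0 *.
set V := \sum_(1 <= t < k.+1) theta t *: y t.
set W := \sum_(1 <= t < k.+1) theta t * F (y t).
(* Only the total weight is known to be positive. If the earlier weights sum to 0, each vanishes and
   the average is [y k.+1]. *)
move: S0; rewrite le_eqVlt => /orP[/eqP S0|S0] IH ST.
  have thz t : (1 <= t < k.+1)%N -> theta t = 0.
    move=> tk; apply/eqP; rewrite eq_le th0' ?andbT//.
    rewrite S0 /S (bigD1_seq t) ?mem_index_iota ?iota_uniq//= lerDl.
    rewrite big_seq_cond; apply: sumr_ge0 => i.
    by rewrite mem_index_iota => /andP[+ _]; rewrite ltnS; exact: th0'.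
  have -> : V = 0 by rewrite /V big_nat big1// => t /thz ->; rewrite scale0r.
  have -> : W = 0 by rewrite /W big_nat big1// => t /thz ->; rewrite mul0r.
  move: ST; rewrite -S0 !add0r => ST.
  by rewrite scalerA mulVf ?gt_eqF// scale1r.
have [XV FV] := IH S0.
have T0 : S + theta k.+1 != 0 by rewrite gt_eqF.
set l := S / (S + theta k.+1).
have -> : (S + theta k.+1)^-1 *: (V + theta k.+1 *: y k.+1) =
    l *: (S^-1 *: V) + (1 - l) *: y k.+1.
  rewrite scalerDr !scalerA; congr (_ *: _ + _ *: _); rewrite /l; field => //.
  by rewrite T0 gt_eqF.
have l01 : 0 <= l <= 1.
  by rewrite /l ler_pdivrMr// mul1r lerDl thS divr_ge0// ltW.
split; first exact: X_conv.
have := F_conv XV XS l01; rewrite -(ler_pM2l ST) => /le_trans; apply.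
have -> : (S + theta k.+1) *
    (l * F (S^-1 *: V) + (1 - l) * F (y k.+1)) =
    S * F (S^-1 *: V) + theta k.+1 * F (y k.+1) by rewrite /l; field.
by rewrite lerD2r.
Qed.

End Jensen.

Section ConvexBridge.
Context {R : realType} {n : nat}.
Implicit Types (X : set 'rV[R]_n) (F : 'rV[R]_n -> R).

Lemma convex_setE X : convex_set X -> forall x y l, X x -> X y -> 0 <= l <= 1 ->
  X (l *: x + (1 - l) *: y).
Proof.
move=> XC x y l Xx Xy /andP[l0 l1].
by have := XC x y (Itv01 l0 l1) (mem_set Xx) (mem_set Xy); rewrite inE.
Qed.

Lemma convex_functionE X F : convex_function X F ->
  forall x y l, X x -> X y -> 0 <= l <= 1 ->
  F (l *: x + (1 - l) *: y) <= l * F x + (1 - l) * F y.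
Proof.
move=> FC x y l Xx Xy /andP[l0 l1].
exact: (FC (Itv01 l0 l1) x y (mem_set Xx) (mem_set Xy)).
Qed.

End ConvexBridge.

(** * Smooth convex functions *)

Lemma derive_grad (R : realType) (n : nat) (f : 'rV[R]_n -> R) x v :
  differentiable f x -> 'D_v f x = dot (grad f x) v.
Proof.
move=> fx; rewrite deriveE// [in LHS](row_sum_delta v) linear_sum.
by apply: eq_bigr => i _; rewrite linearZ mxE deriveE// mulrC.
Qed.

Lemma is_derive_line (R : realType) (n : nat) (f : 'rV[R]_n -> R) x v (s : R) :
  differentiable f (x + s *: v) ->
  is_derive s 1 (fun s => f (x + s *: v)) (dot (grad f (x + s *: v)) v).
Proof.
move=> fd; have fl : is_derive (x + s *: v) v f ('D_v f (x + s *: v)).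
  exact/derivableP/diff_derivable.
have E : (fun h : R => h^-1 *: (((fun s => f (x + s *: v)) \o shift s) (h *: 1)
     - f (x + s *: v))) =
   (fun h : R => h^-1 *: ((f \o shift (x + s *: v)) (h *: v) - f (x + s *: v))).
  apply/funext => h /=; congr (_ *: (f _ - _)).
  by rewrite scaler1 scalerDl addrCA.
rewrite -derive_grad//; apply: DeriveDef.
  by rewrite /derivable E; case: fl.
by rewrite /derive E.
Qed.

Section Smooth.
Context {R : realType} {n : nat}.
Variables (N : 'rV[R]_n -> R) (f : 'rV[R]_n -> R) (Lf : R).
Hypothesis N_norm : is_norm N.
Hypothesis Lf_ge0 : 0 <= Lf.
Hypothesis f_diff : forall x, differentiable f x.
Hypothesis f_smooth : forall x y,
  (dual_norm N (grad f x - grad f y) <= (Lf * N (x - y))%:E)%E.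
Hypothesis f_conv : forall x y (l : R), 0 <= l <= 1 ->
  f (l *: x + (1 - l) *: y) <= l * f x + (1 - l) * f y.
Implicit Types (x y v g d u : 'rV[R]_n).

Lemma grad_lipschitz x v d :
  dot (grad f (x + v)) d <= dot (grad f x) d + Lf * N v * N d.
Proof.
have := dual_norm_dot N_norm d (f_smooth (x + v) x).
by rewrite dotDl dotNl addrAC subrr add0r lerBlDl.
Qed.

(** The mean value theorem is applied to [f] on the line minus its quadratic model, whose derivative
    is nonpositive. Subtracting the model first gives the sharp constant [Lf / 2] without
    integration. *)
Lemma descent_upper x v :
  f (x + v) <= f x + dot (grad f x) v + Lf / 2 * N v ^+ 2.
Proof.
set C := Lf * N v ^+ 2.
pose df s := dot (grad f (x + s *: v)) v - (dot (grad f x) v + C * s).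
pose p s := f (x + s *: v) - (s * dot (grad f x) v + C * (s ^+ 2 / 2)).
have pd (s : R) : is_derive s 1 p (df s).
  have fd := is_derive_line (f_diff (x + s *: v)).
  have pd : is_derive s 1
     (fun s : R => s * dot (grad f x) v + C * (s ^+ 2 / 2))
     (dot (grad f x) v + C * s).
    by apply: is_derive_eq; rewrite /GRing.scale /=; field.
  exact: (is_deriveB fd pd).
have pc : {within `[0, 1], continuous p}.
  apply: derivable_within_continuous => s _.
  by case: (pd s).
have [c] := MVT ltr01 (fun s _ => pd s) pc.
rewrite in_itv /= => /andP[c0 _]; rewrite subr0 mulr1 /p /df.
rewrite scale1r scale0r addr0.
have := grad_lipschitz x (c *: v) v.
rewrite is_norm_scale// gtr0_norm// /C => H.
nra.
Qed.

(** The crude constant [Lf] suffices: the bound only feeds [ge0_of_quadratic], where the size of the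
    quadratic coefficient is irrelevant. *)
Lemma descent_lower x v :
  f x + dot (grad f x) v - Lf * N v ^+ 2 <= f (x + v).
Proof.
have pd s := is_derive_line (f_diff (x + s *: v)).
have pc : {within `[0, 1], continuous (fun s : R => f (x + s *: v))}.
  apply: derivable_within_continuous => s _; by case: (pd s).
have [c] := MVT ltr01 (fun s _ => pd s) pc.
rewrite in_itv /= => /andP[c0 c1]; rewrite subr0 mulr1 scale1r scale0r addr0.
have := grad_lipschitz x (c *: v) (- v).
rewrite (is_norm_scale N_norm) (is_normN N_norm) gtr0_norm// !dotNr => H.
have : 0 <= (1 - c) * (Lf * N v ^+ 2).
  by rewrite mulr_ge0 ?subr_ge0 ?(ltW c1)// mulr_ge0 ?sqr_ge0.
nra.
Qed.

Lemma convex_grad_le x y : f x + dot (grad f x) (y - x) <= f y.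
Proof.
suff : 0 <= f y - f x - dot (grad f x) (y - x) by lra.
apply: (@ge0_of_quadratic _ _ (Lf * N (y - x) ^+ 2)) => l /andP[l0 l1].
have := descent_lower x (l *: (y - x)).
have -> : x + l *: (y - x) = l *: y + (1 - l) *: x.
  by apply/rowP => i; rewrite !mxE; ring.
have /(f_conv y x) : 0 <= l <= 1 by rewrite ltW.
rewrite dotZr is_norm_scale// gtr0_norm//; nra.
Qed.

(** The affine minorant given by [g] lies below the quadratic model of [descent_upper], and both
    agree at [u], so their slopes compare in every direction; the directions [v] and [- v] give
    equality. *)
Lemma subgradient_eq_grad u g v : subdiff setT f u g ->
  dot g v = dot (grad f u) v.
Proof.
move=> sg.
have le w : dot g w <= dot (grad f u) w.
  suff : 0 <= dot (grad f u) w - dot g w by lra.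
  apply: (@ge0_of_quadratic _ _ (Lf / 2 * N w ^+ 2)) => l /andP[l0 l1].
  have := sg (u + l *: w) I.
  have := descent_upper u (l *: w).
  rewrite (addrC u) addrK !dotZr is_norm_scale// gtr0_norm//; nra.
by apply/eqP; rewrite eq_le le /=; have := le (- v); rewrite !dotNr lerN2.
Qed.

End Smooth.

(** * Convex conjugates *)

Section Conjugate.
Context {R : realType} {n : nat}.
Variable f : 'rV[R]_n -> R.
Implicit Types (x y u g : 'rV[R]_n).

Lemma conj_fun_ge g y : dual_dom f g -> dot y g - f y <= conj_fun f g.
Proof.
move=> gd; have le : ((dot y g - f y)%:E <= conjugate f g)%E.
  by apply: ereal_sup_ubound; exists y.
rewrite -lee_fin fineK// fin_numE -ltey gd andbT.
by apply: contraTneq le => ->; rewrite leeNy_eq.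
Qed.

Lemma conj_fun_le g c : (forall y, dot y g - f y <= c) ->
  dual_dom f g /\ conj_fun f g <= c.
Proof.
move=> H; have le : (conjugate f g <= c%:E)%E.
  by apply: ub_ereal_sup => _ [y _ <-]; rewrite lee_fin.
have gd : dual_dom f g by exact: le_lt_trans le (ltry _).
split => //; rewrite -lee_fin fineK// fin_numE -ltey gd andbT.
have : ((dot 0 g - f 0)%:E <= conjugate f g)%E.
  by apply: ereal_sup_ubound; exists 0.
by apply: contraTneq => ->; rewrite leeNy_eq.
Qed.

(** The equality case of the Fenchel-Young inequality. *)
Lemma conj_fun_subdiff u g : subdiff setT f u g ->
  dual_dom f g /\ conj_fun f g = dot u g - f u.
Proof.
move=> sg; have [|gd le] := @conj_fun_le g (dot u g - f u).
  by move=> y; have := sg y I; rewrite dotDr dotNr !(dotC g); lra.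
by split => //; apply/eqP; rewrite eq_le le conj_fun_ge.
Qed.

(** The conjugate is a supremum of affine functions: for each fixed [y], the Fenchel-Young
    inequalities at the [g t] are averaged. *)
Lemma conj_fun_weighted_avg k (theta : nat -> R) (g : nat -> 'rV[R]_n) :
  (forall t, (1 <= t <= k)%N -> 0 <= theta t) ->
  (forall t, (1 <= t <= k)%N -> dual_dom f (g t)) ->
  0 < \sum_(1 <= t < k.+1) theta t ->
  dual_dom f (weighted_avg k theta g) /\
  (\sum_(1 <= t < k.+1) theta t) * conj_fun f (weighted_avg k theta g)
    <= \sum_(1 <= t < k.+1) theta t * conj_fun f (g t).
Proof.
move=> th0 gd S0; rewrite mulrC -ler_pdivlMr//; apply: conj_fun_le => y.
rewrite ler_pdivlMr// /weighted_avg dotZr dot_sumr mulrBl mulrAC mulVf ?gt_eqF//.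
rewrite mul1r mulr_sumr -sumrB big_nat [leRHS]big_nat; apply: ler_sum => t tk.
rewrite dotZr (mulrC (f y)) -mulrBr ler_wpM2l ?th0//.
exact/conj_fun_ge/gd.
Qed.

End Conjugate.

(** * The primal-dual gradient method *)

Section PDG.
Context {R : realType} {n : nat}.
Variables (X : set 'rV[R]_n) (N f h omega : 'rV[R]_n -> R) (Lf mu : R).
Hypothesis X_conv : forall x y l, X x -> X y -> 0 <= l <= 1 ->
  X (l *: x + (1 - l) *: y).
Hypothesis N_norm : is_norm N.
Hypothesis Lf_ge0 : 0 <= Lf.
Hypothesis f_diff : forall x, differentiable f x.
Hypothesis f_smooth : forall x y,
  (dual_norm N (grad f x - grad f y) <= (Lf * N (x - y))%:E)%E.
Hypothesis f_conv : forall x y (l : R), 0 <= l <= 1 ->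
  f (l *: x + (1 - l) *: y) <= l * f x + (1 - l) * f y.
Hypothesis h_conv : forall x y l, X x -> X y -> 0 <= l <= 1 ->
  h (l *: x + (1 - l) *: y) <= l * h x + (1 - l) * h y.
Hypothesis omega_sconv : strongly_convex X N 1 omega.
Hypothesis mu_ge0 : 0 <= mu.
Implicit Types (y v gg d : 'rV[R]_n).

Let J := conj_fun f.
Let Q := gap_fun f h omega mu.

(** On the segment from [x0] to [y], the subgradient inequality bounds [omega] below and strong
    convexity bounds it above; the first-order terms in [l] give the claim. *)
Lemma bregman_ge_sqr x0 w0 y : X x0 -> X y -> subdiff X omega x0 w0 ->
  N (y - x0) ^+ 2 / 2 <= bregman omega w0 x0 y.
Proof.
move=> X0 Xy sw; suff : 0 <= bregman omega w0 x0 y - N (y - x0) ^+ 2 / 2 by lra.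
apply: (@ge0_of_quadratic _ _ (N (y - x0) ^+ 2 / 2)) => l /andP[l0 l1].
have l01 : 0 <= l <= 1 by rewrite ltW.
have := sw _ (X_conv Xy X0 l01).
have := omega_sconv Xy X0 l01.
have -> : l *: y + (1 - l) *: x0 - x0 = l *: (y - x0).
  by apply/rowP => i; rewrite !mxE; ring.
rewrite dotZr /bregman; nra.
Qed.

Lemma subdiff_grad x0 : subdiff setT f x0 (grad f x0).
Proof.
move=> y _.
exact: convex_grad_le N_norm Lf_ge0 f_diff f_smooth f_conv _ _.
Qed.

Lemma conj_fun_grad x0 :
  dual_dom f (grad f x0) /\ J (grad f x0) = dot x0 (grad f x0) - f x0.
Proof. exact/conj_fun_subdiff/subdiff_grad. Qed.

(** Up to a constant the dual objective is [(1 + tau) * (J g - dot u g)], with [u] the averaged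
    point. The competitor [grad f u] gives [J g - dot u g] the value [- f u], which forces equality
    in Fenchel-Young at [g1]. *)
Lemma dual_prox_subdiff xt v0 g0 tau g1 : 0 <= tau ->
  g1 \in dual_prox_map f xt v0 g0 tau ->
  subdiff setT f ((1 + tau)^-1 *: (xt + tau *: v0)) g1.
Proof.
move=> tau0; rewrite inE => -[g1d g1min] y _.
set u := (1 + tau)^-1 *: _.
have tau1 : 0 < 1 + tau by lra.
have uE v : (1 + tau) * dot u v = dot xt v + tau * dot v0 v.
  by rewrite /u dotZl mulrA mulfV ?gt_eqF// mul1r !dotE.
clearbody u; have [Gd GE] := conj_fun_grad u.
have := g1min _ Gd; have := uE g1; have := uE (grad f u); have := conj_fun_ge y g1d.
rewrite /bregman -/J GE !dotE !(dotC _ g1) !(dotC _ (grad f u)).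
move=> H1 H2 H3 H4.
have : (1 + tau) * (J g1 - dot g1 u) <= (1 + tau) * (- f u) by lra.
rewrite ler_pM2l//; lra.
Qed.

(** Fenchel-Young for [gg] is tested at the shifted point [u + d], where smoothness bounds [f] from
    above. *)
Lemma dual_bregman_ge u g0 gg d : subdiff setT f u g0 -> dual_dom f gg ->
  dot (gg - g0) d - Lf / 2 * N d ^+ 2 <= bregman J u g0 gg.
Proof.
move=> sg gd; have [_ JE] := conj_fun_subdiff sg.
have := conj_fun_ge (u + d) gd.
have := descent_upper N_norm f_diff f_smooth u d.
rewrite -(subgradient_eq_grad N_norm f_diff f_smooth _ sg).
rewrite /bregman {2}/J JE -/J !dotE (dotC gg d); lra.
Qed.

(** At [grad f y] the dual distance equals the Bregman distance of [f] with arguments exchanged,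
    [f u - f y - dot (grad f y) (u - y)]. *)
Lemma dual_bregman_grad_le u g0 y : subdiff setT f u g0 ->
  bregman J u g0 (grad f y) <= Lf / 2 * N (u - y) ^+ 2.
Proof.
move=> sg; have [_ JE] := conj_fun_subdiff sg.
have [_ GE] := conj_fun_grad y.
have := descent_upper N_norm f_diff f_smooth y (u - y).
rewrite addrC subrK /bregman GE {1}/J JE !dotE !(dotC (grad f y)); lra.
Qed.

(** The primal terms come from the variational inequality and the subgradient [h']. The dual terms
    form an identity, obtained by pairing the recursion for [u1] with [gg] and [g1]. *)
Lemma gap_step_le x0 x1 xt w0 w1 u0 u1 g0 g1 h' (tau eta : R) y gg :
  0 < 1 + tau -> X y -> subdiff X h x1 h' ->
  0 <= dot (g1 + h' + (mu + eta) *: w1 - eta *: w0) (y - x1) ->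
  u1 = (1 + tau)^-1 *: (xt + tau *: u0) ->
  Q (x1, g1) (y, gg) <=
    eta * bregman omega w0 x0 y - (mu + eta) * bregman omega w1 x1 y
    - eta * bregman omega w0 x0 x1
    + tau * bregman J u0 g0 gg - (1 + tau) * bregman J u1 g1 gg
    - tau * bregman J u0 g0 g1 + dot (x1 - xt) (gg - g1).
Proof.
move=> tau1 Xy /(_ _ Xy) hy VI uE.
have uE' v : (1 + tau) * dot u1 v = dot xt v + tau * dot u0 v.
  by rewrite uE dotZl mulrA mulfV ?gt_eqF// mul1r !dotE.
move: hy VI (uE' gg) (uE' g1).
rewrite /Q /gap_fun /bregman /= !dotE !(dotC g1) -/J; lra.
Qed.

(** * The potential along a run, under parameter conditions covering both cases *)

Section Run.
Variables (k : nat) (tau eta alpha : nat -> R) (x g w u : nat -> 'rV[R]_n).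
Hypothesis run : pdg_run X f h omega mu k tau eta alpha x g w u.
Hypothesis tau_ge0 : forall t, (1 <= t <= k)%N -> 0 <= tau t.
Hypothesis eta_ge0 : forall t, (1 <= t <= k)%N -> 0 <= eta t.
Hypothesis Lf_le : forall t, (1 <= t <= k)%N -> Lf <= eta t * (1 + tau t).
Hypothesis alpha_ge0 : forall t, (1 < t <= k)%N -> 0 <= alpha t.
Hypothesis eta_le : forall t, (1 < t <= k)%N ->
  eta t <= alpha t * (mu + eta t.-1).
Hypothesis tauE : forall t, (1 < t <= k)%N -> tau t = alpha t * (1 + tau t.-1).

Lemma run_primal t : (t <= k)%N -> X (x t) /\ subdiff X omega (x t) (w t).
Proof.
case: t => [_|t tk]; first by case: run.
by case: run => _ _ _ _ /(_ t.+1 tk)[_ _]; rewrite inE => -[].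
Qed.

Lemma run_dual t : (t <= k)%N -> subdiff setT f (u t) (g t).
Proof.
case: t => [_|t tk]; first by case: run => _ _ -> -> _; exact: subdiff_grad.
case: run => _ _ _ _ /(_ t.+1 tk)[+ -> _ _ _].
exact/dual_prox_subdiff/tau_ge0.
Qed.

Definition potential t y gg : R :=
  (mu + eta t) * bregman omega (w t) (x t) y
  + (1 + tau t) * bregman J (u t) (g t) gg
  - dot (x t - x t.-1) (gg - g t)
  + eta t * bregman omega (w t.-1) (x t.-1) (x t).

(* Fenchel-Young with the scaled displacement [d / (1 + tau t)]. *)
Lemma momentum_le t gg : (1 <= t <= k)%N -> dual_dom f gg ->
  dot (x t - x t.-1) (gg - g t) <=
  (1 + tau t) * bregman J (u t) (g t) gg
  + eta t * bregman omega (w t.-1) (x t.-1) (x t).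
Proof.
move=> tk gd; have /andP[t1 tk'] := tk.
have tp : (t.-1 <= k)%N by rewrite (leq_trans (leq_pred t)).
have [Xt _] := run_primal tk'.
have [Xp sp] := run_primal tp.
have := bregman_ge_sqr Xp Xt sp.
set d := x t - x t.-1; set P := bregman omega _ _ _; set D := bregman J _ _ _ => HP.
have tau1 : 0 < 1 + tau t by have := tau_ge0 tk; lra.
have := dual_bregman_ge ((1 + tau t)^-1 *: d) (run_dual tk') gd.
rewrite -/D dotZr is_norm_scale// gtr0_norm ?invr_gt0// dotC => HD.
have : (1 + tau t) * ((1 + tau t)^-1 * dot d (gg - g t)
   - Lf / 2 * ((1 + tau t)^-1 * N d) ^+ 2) <= (1 + tau t) * D.
  by rewrite ler_pM2l.
have -> : (1 + tau t) * ((1 + tau t)^-1 * dot d (gg - g t)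
   - Lf / 2 * ((1 + tau t)^-1 * N d) ^+ 2) =
   dot d (gg - g t) - Lf / (1 + tau t) * (N d ^+ 2 / 2).
  by field; rewrite gt_eqF.
have : Lf / (1 + tau t) * (N d ^+ 2 / 2) <= eta t * (N d ^+ 2 / 2).
  by rewrite ler_wpM2r ?ler_pdivrMr ?Lf_le// mulr_ge0 ?sqr_ge0.
have : eta t * (N d ^+ 2 / 2) <= eta t * P by rewrite ler_wpM2l ?eta_ge0.
lra.
Qed.

(** By [momentum_le] the remaining terms of the potential have a nonnegative sum. *)
Lemma potential_ge t y gg : (1 <= t <= k)%N -> dual_dom f gg ->
  (mu + eta t) * bregman omega (w t) (x t) y <= potential t y gg.
Proof. by move=> tk /(momentum_le tk); rewrite /potential; lra. Qed.

Lemma potential1 y gg : (0 < k)%N -> X y -> dual_dom f gg ->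
  Q (x 1%N, g 1%N) (y, gg) + potential 1 y gg <=
  eta 1%N * bregman omega (w 0%N) (x 0%N) y + tau 1%N * bregman J (u 0%N) (g 0%N) gg.
Proof.
move=> k0 Xy gd.
have tau1 : 0 <= tau 1%N by exact: tau_ge0.
case: run => _ _ _ _ /(_ 1%N k0)[g1 u1E _ _ [h' sh /(_ y Xy) VI]].
have tau1' : 0 < 1 + tau 1%N by lra.
have := gap_step_le (x 0%N) (g 0%N) gg tau1' Xy sh VI u1E.
have [gd1 _] := conj_fun_subdiff (run_dual k0).
(* The choice [d = 0] says that the dual distance is nonnegative. *)
have := dual_bregman_ge 0 (run_dual (leq0n k)) gd1.
rewrite (is_norm0 N_norm) expr0n mulr0 dotC dot0l subrr /potential /=.
rewrite subrr scaler0 add0r.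
move=> /(mulr_ge0 tau1); lra.
Qed.

(** Extrapolation splits [x^t - xt^t] into [D_t - alpha_t D_(t-1)]. Paired with [gg - g^t], this
    yields the momentum terms of both potentials and a residual
    [alpha_t <D_(t-1), g^t - g^(t-1)>]. *)
Lemma potential_step t y gg : (t.+2 <= k)%N -> X y -> dual_dom f gg ->
  Q (x t.+2, g t.+2) (y, gg) + potential t.+2 y gg <=
  alpha t.+2 * potential t.+1 y gg.
Proof.
move=> tk Xy gd.
have tk1 : (1 <= t.+1 <= k)%N by rewrite /= ltnW.
have tk2 : (1 < t.+2 <= k)%N by [].
have tau2 : 0 < 1 + tau t.+2.
  by have := tau_ge0 (tk : 1 <= t.+2 <= k)%N; lra.
case: run => _ _ _ _ /(_ t.+2 tk)[g1 u1E _ _ [h' sh /(_ y Xy) VI]].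
have := gap_step_le (x t.+1) (g t.+1) gg tau2 Xy sh VI u1E.
have [gd1 _] := conj_fun_subdiff (run_dual tk).
(* The residual is absorbed by taking the new dual iterate as the competitor at the previous
   step. *)
have := momentum_le tk1 gd1.
move=> /(ler_wpM2l (alpha_ge0 tk2)).
have P0 : 0 <= bregman omega (w t.+1) (x t.+1) y.
  have [Xp sp] := run_primal (ltnW tk).
  by apply: le_trans (bregman_ge_sqr Xp Xy sp); rewrite mulr_ge0 ?sqr_ge0.
have := ler_wpM2r P0 (eta_le tk2).
rewrite /potential /= (tauE tk2) !dotE /=; lra.
Qed.

(** The weight [theta t] turns the factor [alpha t] into [theta t.-1], so the potentials
    telescope. *)
Lemma weighted_gap_le (theta : nat -> R) y gg j : X y -> dual_dom f gg ->
  (forall t, (1 <= t <= k)%N -> 0 <= theta t) ->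
  (forall t, (1 < t <= k)%N -> theta t * alpha t = theta t.-1) ->
  (1 <= j <= k)%N ->
  \sum_(1 <= t < j.+1) theta t * Q (x t, g t) (y, gg)
    + theta j * potential j y gg <=
  theta 1%N * (eta 1%N * bregman omega (w 0%N) (x 0%N) y
               + tau 1%N * bregman J (u 0%N) (g 0%N) gg).
Proof.
move=> Xy gd th0 thE; elim: j => // -[_ /= k1|j IH /= jk].
  rewrite big_nat1 -mulrDr ler_wpM2l ?th0//; exact: potential1.
apply: le_trans (IH _); last exact: ltnW.
rewrite big_nat_recr//= -addrA lerD2l -mulrDr.
have <- : theta j.+2 * alpha j.+2 = theta j.+1 by exact: thE.
by rewrite -mulrA ler_wpM2l ?th0//; exact: potential_step.
Qed.

Lemma potential_contraction (a : R) y gg j : X y -> dual_dom f gg ->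
  (forall t, (1 < t <= k)%N -> alpha t = a) -> 0 <= a ->
  (forall t, (1 <= t <= k)%N -> 0 <= Q (x t, g t) (y, gg)) ->
  (j.+1 <= k)%N ->
  potential j.+1 y gg <=
  a ^+ j * (eta 1%N * bregman omega (w 0%N) (x 0%N) y
            + tau 1%N * bregman J (u 0%N) (g 0%N) gg).
Proof.
move=> Xy gd aE a0 Q0; elim: j => [k1|j IH jk].
  by rewrite expr0 mul1r; have := potential1 k1 Xy gd; have := Q0 1%N k1; lra.
have := potential_step jk Xy gd; have := Q0 j.+2 jk.
have := ler_wpM2l a0 (IH (ltnW jk)).
rewrite (aE j.+2 jk) exprS -mulrA; lra.
Qed.

(** * Gap at the averaged iterates *)

Section Average.
Variable theta : nat -> R.
Hypothesis theta_ge0 : forall t, (1 <= t <= k)%N -> 0 <= theta t.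
Hypothesis theta_gt0 : 0 < \sum_(1 <= t < k.+1) theta t.
Let xbar := weighted_avg k theta x.
Let gbar := weighted_avg k theta g.

Lemma omega_conv x0 y l : X x0 -> X y -> 0 <= l <= 1 ->
  omega (l *: x0 + (1 - l) *: y) <= l * omega x0 + (1 - l) * omega y.
Proof.
move=> X0 Xy l01; apply: le_trans (omega_sconv X0 Xy l01) _.
rewrite gerBl mulr_ge0 ?divr_ge0// mulr_ge0 ?sqr_ge0//.
by case/andP: l01 => ? ?; rewrite mulr_ge0 ?subr_ge0.
Qed.

Lemma xbar_in : X xbar.
Proof.
apply: (jensen_weighted_avg X_conv h_conv theta_ge0 _ theta_gt0).1 => t /andP[_ tk].
by case: (run_primal tk).
Qed.

Lemma gbar_in : dual_dom f gbar.
Proof.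
apply: (conj_fun_weighted_avg theta_ge0 _ theta_gt0).1 => t /andP[_ tk].
exact: (conj_fun_subdiff (run_dual tk)).1.
Qed.

Lemma gap_fun_avg_le y gg :
  (\sum_(1 <= t < k.+1) theta t) * Q (xbar, gbar) (y, gg) <=
  \sum_(1 <= t < k.+1) theta t * Q (x t, g t) (y, gg).
Proof.
pose F v := h v + mu * omega v + dot v gg.
have F_conv x0 x1 l : X x0 -> X x1 -> 0 <= l <= 1 ->
    F (l *: x0 + (1 - l) *: x1) <= l * F x0 + (1 - l) * F x1.
  move=> X0 X1 l01; rewrite /F !dotE.
  have := h_conv X0 X1 l01; have := ler_wpM2l mu_ge0 (omega_conv X0 X1 l01); lra.
have [|_ HF] := jensen_weighted_avg (y := x) X_conv F_conv theta_ge0 _ theta_gt0.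
  by move=> t /andP[_ /run_primal[]].
have [|_ HJ] := conj_fun_weighted_avg (f := f) (g := g) theta_ge0 _ theta_gt0.
  by move=> t /andP[_ tk]; exact: (conj_fun_subdiff (run_dual tk)).1.
have Hd : (\sum_(1 <= t < k.+1) theta t) * dot y gbar =
    \sum_(1 <= t < k.+1) theta t * dot y (g t).
  rewrite /gbar /weighted_avg dotZr mulrA mulfV ?gt_eqF// mul1r dot_sumr.
  by apply: eq_bigr => t _; rewrite dotZr.
have -> : \sum_(1 <= t < k.+1) theta t * Q (x t, g t) (y, gg) =
   \sum_(1 <= t < k.+1) theta t * F (x t) +
   \sum_(1 <= t < k.+1) theta t * J (g t) -
   \sum_(1 <= t < k.+1) theta t * dot y (g t) -
   (\sum_(1 <= t < k.+1) theta t) * (J gg + h y + mu * omega y).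
  rewrite mulr_suml -big_split -!sumrB /=; apply: eq_bigr => t _.
  by rewrite /Q /gap_fun /F /=; rewrite -/J; ring.
move: HF HJ Hd; rewrite -/xbar -/gbar /Q /gap_fun /F /= -/J; lra.
Qed.

Lemma gap_avg_le y gg : (0 < k)%N -> X y -> dual_dom f gg ->
  (forall t, (1 < t <= k)%N -> theta t * alpha t = theta t.-1) ->
  (\sum_(1 <= t < k.+1) theta t) * Q (xbar, gbar) (y, gg) <=
  theta 1%N * (eta 1%N * bregman omega (w 0%N) (x 0%N) y
               + tau 1%N * bregman J (u 0%N) (g 0%N) gg).
Proof.
move=> k0 Xy gd thE; have kk : (1 <= k <= k)%N by rewrite k0 leqnn.
apply: le_trans (gap_fun_avg_le y gg) _.
apply: le_trans (weighted_gap_le Xy gd theta_ge0 thE kk).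
rewrite lerDl mulr_ge0 ?theta_ge0//.
apply: le_trans (potential_ge y kk gd).
have [Xk sk] := run_primal (leqnn k).
apply: mulr_ge0; first by rewrite addr_ge0 ?eta_ge0.
by apply: le_trans (bregman_ge_sqr Xk Xy sk); rewrite mulr_ge0 ?sqr_ge0.
Qed.

End Average.
End Run.
(** Minimality of [xs] along the segment to [y] gives its variational inequality; Fenchel-Young for
    [gg] at [xs] supplies the dual half. *)
Lemma saddle_gap_ge0 xs y gg : xs \in argmin X (composite f h omega mu) ->
  X y -> dual_dom f gg -> 0 <= Q (y, gg) (xs, grad f xs).
Proof.
rewrite inE => -[Xxs xs_min] Xy gd.
have [_ GE] := conj_fun_grad xs.
have le_gg := conj_fun_ge xs gd.
suff : 0 <= dot (grad f xs) (y - xs) + (h y - h xs + mu * (omega y - omega xs)).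
  by move: le_gg; rewrite /Q /gap_fun /= -/J GE !dotE !(dotC (grad f xs)); lra.
apply: (@ge0_of_quadratic _ _ (Lf / 2 * N (y - xs) ^+ 2)) => l /andP[l0 l1].
have l01 : 0 <= l <= 1 by rewrite ltW.
have := xs_min _ (X_conv Xy Xxs l01).
have := h_conv Xy Xxs l01.
have := ler_wpM2l mu_ge0 (omega_conv Xy Xxs l01).
have := descent_upper N_norm f_diff f_smooth xs (l *: (y - xs)).
have -> : xs + l *: (y - xs) = l *: y + (1 - l) *: xs.
  by apply/rowP => i; rewrite !mxE; ring.
rewrite dotZr is_norm_scale// gtr0_norm// /composite; lra.
Qed.

Lemma composite_gap_le xs y gg : dual_dom f gg ->
  composite f h omega mu y - composite f h omega mu xs
    <= Q (y, gg) (xs, grad f y).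
Proof.
move=> gd; have [_ GE] := conj_fun_grad y.
have := conj_fun_ge xs gd.
rewrite /Q /gap_fun /composite /= -/J GE; lra.
Qed.

(** [grad f y] maximises [dot y g - J g] over [g], with value [f y]. *)
Lemma gap_fun_le_grad y gg xs g1 : dual_dom f g1 ->
  Q (y, gg) (xs, g1) <= Q (y, gg) (xs, grad f y).
Proof.
move=> gd; have [_ GE] := conj_fun_grad y.
have := conj_fun_ge y gd.
rewrite /Q /gap_fun /= -/J GE; lra.
Qed.

(** The witness [x2] may differ from [x1]: in the linear case the initial dual distance is
    controlled by [P0] at the averaged iterate. *)
Lemma gap_bounds xs y gg c (P0 : 'rV[R]_n -> R) : X xs -> dual_dom f gg ->
  0 <= c ->
  (forall g1, dual_dom f g1 -> Q (y, gg) (xs, g1) <= c * P0 xs) ->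
  (forall x1 g1, X x1 -> dual_dom f g1 ->
     exists2 x2, X x2 & Q (y, gg) (x1, g1) <= c * P0 x2) ->
  let Psi := composite f h omega mu in
  [/\ ((Psi y - Psi xs)%:E <= gap_star f h omega mu xs (y, gg))%E,
      (gap_star f h omega mu xs (y, gg) <= (c * P0 xs)%:E)%E,
      ((Psi y - Psi xs)%:E <= gap X f h omega mu (y, gg))%E &
      (gap X f h omega mu (y, gg) <=
        c%:E * ereal_sup [set (P0 x1)%:E | x1 in X])%E].
Proof.
move=> Xxs gd c0 Hstar Hgap Psi; have [Gd _] := conj_fun_grad y; split.
- apply: (@le_trans _ _ (Q (y, gg) (xs, grad f y))%:E).
    by rewrite lee_fin composite_gap_le.
  by apply: ereal_sup_ubound; exists (grad f y).
- by apply: ub_ereal_sup => _ [g1 g1d <-]; rewrite lee_fin Hstar.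
- apply: (@le_trans _ _ (Q (y, gg) (xs, grad f y))%:E).
    by rewrite lee_fin composite_gap_le.
  by apply: ereal_sup_ubound; exists (xs, grad f y).
- apply: ub_ereal_sup => _ [[x1 g1] [/= Xx1 g1d] <-].
  have [x2 Xx2 le2] := Hgap _ _ Xx1 g1d.
  apply: (@le_trans _ _ (c * P0 x2)%:E); first by rewrite lee_fin.
  by rewrite EFinM lee_wpmul2l ?lee_fin//; apply: ereal_sup_ubound; exists x2.
Qed.

(** * Sublinear rate, case (b) *)

Section SublinearRate.
Variables (k : nat) (tau eta alpha theta : nat -> R).
Variables (x g w u : nat -> 'rV[R]_n).
Hypothesis run : pdg_run X f h omega mu k tau eta alpha x g w u.
Hypothesis k_gt0 : (0 < k)%N.
Hypothesis params : forall t, (1 <= t <= k)%N ->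
  [/\ tau t = (t%:R - 1) / 2, eta t = 4 * Lf / t%:R,
      alpha t = (t%:R - 1) / t%:R & theta t = t%:R].

Lemma sum_natr_weights :
  \sum_(1 <= t < k.+1) theta t = k%:R * (k%:R + 1) / 2 :> R.
Proof.
have -> : \sum_(1 <= t < k.+1) theta t = \sum_(1 <= t < k.+1) t%:R.
  by rewrite !big_nat; apply: eq_bigr => t /params[].
elim: k => [|j IH]; first by rewrite big_geq// mul0r mul0r.
by rewrite big_nat_recr//= IH -natr1; field.
Qed.

Let tpos t : (1 <= t <= k)%N -> 1 <= t%:R :> R.
Proof. by case/andP; rewrite ler1n. Qed.

Let pred_range t : (1 < t <= k)%N ->
  [/\ (1 <= t <= k)%N, (1 <= t.-1 <= k)%N, t.-1%:R = t%:R - 1 :> R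
    & 2 <= t%:R :> R].
Proof.
case: t => [|[|t]]//= tk; rewrite tk ltnW// -!natr1; split=> //; first by ring.
by have := ler0n R t; lra.
Qed.

Let tau0 t : (1 <= t <= k)%N -> 0 <= tau t.
Proof. by move=> tk; have [-> _ _ _] := params tk; have := tpos tk; lra. Qed.

Let eta0 t : (1 <= t <= k)%N -> 0 <= eta t.
Proof. by move=> tk; have [_ -> _ _] := params tk; rewrite divr_ge0 ?mulr_ge0. Qed.

Let Lf_le t : (1 <= t <= k)%N -> Lf <= eta t * (1 + tau t).
Proof.
move=> tk; have [-> -> _ _] := params tk; have t1 := tpos tk.
have -> : 4 * Lf / t%:R * (1 + (t%:R - 1) / 2) = 2 * Lf + 2 * (Lf / t%:R).
  by field; rewrite gt_eqF//; lra.
have : 0 <= Lf / t%:R by rewrite divr_ge0.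
by move: Lf_ge0; lra.
Qed.

Let alpha0 t : (1 < t <= k)%N -> 0 <= alpha t.
Proof.
move=> /pred_range[tk _ _ t2]; have [_ _ -> _] := params tk.
by rewrite divr_ge0//; lra.
Qed.

Let eta_le t : (1 < t <= k)%N -> eta t <= alpha t * (mu + eta t.-1).
Proof.
move=> /pred_range[/params[_ -> -> _] /params[_ -> _ _] -> t2].
have -> : (t%:R - 1) / t%:R * (mu + 4 * Lf / (t%:R - 1)) =
    (t%:R - 1) / t%:R * mu + 4 * Lf / t%:R.
  by field; apply/andP; split; rewrite gt_eqF//; lra.
by rewrite lerDr mulr_ge0// divr_ge0//; lra.
Qed.

Let tauE t : (1 < t <= k)%N -> tau t = alpha t * (1 + tau t.-1).
Proof.
move=> /pred_range[/params[-> _ -> _] /params[-> _ _ _] -> t2].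
by field; rewrite gt_eqF//; lra.
Qed.

Let th0 t : (1 <= t <= k)%N -> 0 <= theta t.
Proof. by move=> /params[_ _ _ ->]. Qed.

Let thE t : (1 < t <= k)%N -> theta t * alpha t = theta t.-1.
Proof.
move=> /pred_range[/params[_ _ -> ->] /params[_ _ _ ->] -> t2].
by field; rewrite gt_eqF//; lra.
Qed.

Let S0 : 0 < \sum_(1 <= t < k.+1) theta t.
Proof. by rewrite sum_natr_weights divr_gt0// mulr_gt0 ?ltr0n// ltr_wpDl. Qed.

Lemma sublinear_gap y gg : X y -> dual_dom f gg ->
  Q (weighted_avg k theta x, weighted_avg k theta g) (y, gg) <=
  8 * Lf / (k%:R * (k%:R + 1)) * bregman omega (w 0%N) (x 0%N) y.
Proof.
move=> Xy gd.
have := gap_avg_le run tau0 eta0 Lf_le alpha0 eta_le tauE th0 S0 k_gt0 Xy gd thE.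
(* At [t = 1], [tau] vanishes and removes the dual distance. What remains is [4 * Lf] times the
   primal distance, to be divided by the total weight [k (k + 1) / 2]. *)
have [-> -> _ ->] := params (k_gt0 : 1 <= 1 <= k)%N.
rewrite mulrC -ler_pdivlMr// sum_natr_weights => /le_trans; apply.
rewrite le_eqVlt; apply/orP; left; apply/eqP; field.
have k1 : 0 < k%:R :> R by rewrite ltr0n.
by apply/andP; split; rewrite gt_eqF//; lra.
Qed.

Lemma sublinear_gap_bounds xs : X xs ->
  let zbar := (weighted_avg k theta x, weighted_avg k theta g) in
  let P0 := bregman omega (w 0%N) (x 0%N) in
  let Psi := composite f h omega mu in
  let c := 8 * Lf / (k%:R * (k%:R + 1)) in
  [/\ ((Psi zbar.1 - Psi xs)%:E <= gap_star f h omega mu xs zbar)%E,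
      (gap_star f h omega mu xs zbar <= (c * P0 xs)%:E)%E,
      ((Psi zbar.1 - Psi xs)%:E <= gap X f h omega mu zbar)%E &
      (gap X f h omega mu zbar <=
        c%:E * ereal_sup [set (P0 y)%:E | y in X])%E].
Proof.
move=> Xxs zbar P0 Psi c; apply: gap_bounds => //.
- exact: (gbar_in run).
- by rewrite divr_ge0 ?mulr_ge0// addr_ge0.
- by move=> g1; exact: sublinear_gap.
- by move=> y g1 Xy gd; exists y => //; exact: sublinear_gap.
Qed.

End SublinearRate.

(** * Linear rate, case (a) *)

Section LinearRate.
Variables (k : nat) (tau eta alpha : nat -> R) (s : R).
Variables (x g w u : nat -> 'rV[R]_n) (xs : 'rV[R]_n).
Hypothesis run : pdg_run X f h omega mu k tau eta alpha x g w u.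
Hypothesis k_gt0 : (0 < k)%N.
Hypothesis xs_opt : xs \in argmin X (composite f h omega mu).
Hypothesis mu_gt0 : 0 < mu.
Hypothesis s_ge0 : 0 <= s.
(** Here [s] stands for the square root of [2 * Lf / mu], so the parameter relations become rational
    in [s]. *)
Hypothesis LfE : Lf = mu * (s ^+ 2 / 2).
Let a := s / (1 + s).
Hypothesis params : forall t, (1 <= t <= k)%N ->
  [/\ tau t = s, eta t = mu * s & alpha t = a].
(** Its square is the bracket [1 + Lf / mu * (2 + Lf / mu)] of the gap bounds. *)
Let q := 1 + Lf / mu.
Let P0 := bregman omega (w 0%N) (x 0%N).

Let s1 : 0 < 1 + s. Proof. by move: s_ge0; lra. Qed.

Let a_ge0 : 0 <= a. Proof. by rewrite divr_ge0// ltW. Qed.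

Let a_s1 : a * (1 + s) = s. Proof. by rewrite /a divfK ?gt_eqF. Qed.

Let qE : q = 1 + s ^+ 2 / 2.
Proof. by rewrite /q LfE; field; rewrite gt_eqF. Qed.

Let mu_q : mu * q = mu + Lf.
Proof. by rewrite /q; field; rewrite gt_eqF. Qed.

Let a_lt1 : a < 1. Proof. by rewrite /a ltr_pdivrMr//; move: s_ge0; lra. Qed.

Let pred_range t : (1 < t <= k)%N -> (1 <= t <= k)%N /\ (1 <= t.-1 <= k)%N.
Proof. by case: t => [|[|t]]//= tk; rewrite tk ltnW. Qed.

Let tau0 t : (1 <= t <= k)%N -> 0 <= tau t.
Proof. by move=> /params[-> _ _]. Qed.

Let eta0 t : (1 <= t <= k)%N -> 0 <= eta t.
Proof. by move=> /params[_ -> _]; rewrite mulr_ge0. Qed.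

Let Lf_le t : (1 <= t <= k)%N -> Lf <= eta t * (1 + tau t).
Proof.
move=> /params[-> -> _]; rewrite LfE -mulrA ler_wpM2l//.
by have := sqr_ge0 s; move: s_ge0; lra.
Qed.

Let alpha0 t : (1 < t <= k)%N -> 0 <= alpha t.
Proof. by move=> /pred_range[/params[_ _ ->]]. Qed.

Let eta_le t : (1 < t <= k)%N -> eta t <= alpha t * (mu + eta t.-1).
Proof.
move=> /pred_range[/params[_ -> ->] /params[_ -> _]].
by move: a_s1 => H; rewrite -[in leLHS]H; lra.
Qed.

Let tauE t : (1 < t <= k)%N -> tau t = alpha t * (1 + tau t.-1).
Proof. by move=> /pred_range[/params[-> _ ->] /params[-> _ _]]. Qed.

Let run0 := run_primal run (leq0n k).

Let Xxs : X xs. Proof. by move: xs_opt; rewrite inE => -[]. Qed.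

Let P0_ge y : X y -> N (y - x 0%N) ^+ 2 / 2 <= P0 y.
Proof. by move=> Xy; apply: bregman_ge_sqr => //; case: run0. Qed.

Let P0_ge0 y : X y -> 0 <= P0 y.
Proof. by move=> /P0_ge; apply: le_trans; rewrite mulr_ge0 ?sqr_ge0. Qed.

Lemma dual_bregman0_le y : X y ->
  bregman J (u 0%N) (g 0%N) (grad f y) <= Lf * (N (y - x 0%N) ^+ 2 / 2).
Proof.
move=> Xy; have := dual_bregman_grad_le y (run_dual run tau0 (leq0n k)).
case: run => _ _ _ -> _; rewrite (is_norm_dist N_norm); lra.
Qed.

Lemma linear_rate j : (1 <= j <= k)%N ->
  bregman omega (w j) (x j) xs <= q * a ^+ j * P0 xs.
Proof.
case: j => // j /= jk.
have [Gd _] := conj_fun_grad xs.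
have Q0 t : (1 <= t <= k)%N -> 0 <= Q (x t, g t) (xs, grad f xs).
  move=> /andP[_ tk]; apply: saddle_gap_ge0 => //.
    by case: (run_primal run tk).
  exact: (conj_fun_subdiff (run_dual run tau0 tk)).1.
have aE t : (1 < t <= k)%N -> alpha t = a by move=> /pred_range[/params[_ _ ->]].
have := potential_contraction run tau0 eta0 Lf_le alpha0 eta_le tauE Xxs Gd aE
  a_ge0 Q0 jk.
have := potential_ge run tau0 eta0 Lf_le xs (jk : 1 <= j.+1 <= k)%N Gd.
have [_ -> _] := params (jk : 1 <= j.+1 <= k)%N.
have [-> -> _] := params (k_gt0 : 1 <= 1 <= k)%N.
have D0 := dual_bregman0_le Xxs.
have PN := ler_wpM2l Lf_ge0 (P0_ge Xxs).
move=> /le_trans H /H{H} H.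
(* [mu * (1 + s)] is the weight of the primal distance in the potential; [s = a * (1 + s)] provides
   the last factor [a]. *)
have : (mu * (1 + s)) * bregman omega (w j.+1) (x j.+1) xs <=
    (mu * (1 + s)) * (q * a ^+ j.+1 * P0 xs).
  have -> : mu * (1 + s) * (q * a ^+ j.+1 * P0 xs)
      = a ^+ j * (s * ((mu * q) * P0 xs)).
    by rewrite exprS -[in RHS]a_s1; ring.
  rewrite mu_q; have -> : mu * (1 + s) = mu + mu * s by ring.
  apply: le_trans H _; rewrite ler_wpM2l ?exprn_ge0//.
  rewrite [mu * s]mulrC -mulrA -mulrDr ler_wpM2l//.
  by rewrite mulrDl lerD2l; exact: le_trans D0 PN.
by rewrite ler_pM2l// mulr_gt0.
Qed.

(** * Linear decay of the gaps *)

Section Gap.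
Variable theta : nat -> R.
Hypothesis s_gt0 : 0 < s.
Hypothesis thetaE : forall t, (1 <= t <= k)%N -> theta t = 1 / a ^+ t.
Let xbar := weighted_avg k theta x.
Let gbar := weighted_avg k theta g.

Let a_gt0 : 0 < a. Proof. by rewrite divr_gt0. Qed.

Let th0 t : (1 <= t <= k)%N -> 0 <= theta t.
Proof. by move=> /thetaE ->; rewrite divr_ge0// exprn_ge0. Qed.

Let thE t : (1 < t <= k)%N -> theta t * alpha t = theta t.-1.
Proof.
case: t => [|[|t]]//= tk; have [tk1 tk2] := pred_range (tk : 1 < t.+2 <= k)%N.
have [_ _ ->] := params tk1; rewrite !thetaE// !exprS; field.
by rewrite ?expf_neq0 gt_eqF.
Qed.

Lemma sum_geometric_weights :
  \sum_(1 <= t < k.+1) theta t = (1 + s) * (1 / a ^+ k - 1).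
Proof.
have -> : \sum_(1 <= t < k.+1) theta t = \sum_(1 <= t < k.+1) 1 / a ^+ t.
  by rewrite !big_nat; apply: eq_bigr => t /thetaE.
elim: k => [|j IH]; first by rewrite big_geq// expr0 divr1 subrr mulr0.
rewrite big_nat_recr//= IH exprS.
have aj : a ^+ j != 0 by rewrite expf_neq0 ?gt_eqF.
have -> : 1 / (a * a ^+ j) = (1 + s) / (s * a ^+ j).
  by rewrite -[in s * _]a_s1; field; rewrite aj !gt_eqF.
by field; rewrite aj gt_eqF.
Qed.

Let ak_lt1 : a ^+ k < 1. Proof. by rewrite exprn_ilt1// -lt0n. Qed.

Let ak_gt0 : 0 < a ^+ k. Proof. exact: exprn_gt0. Qed.

Let S0 : 0 < \sum_(1 <= t < k.+1) theta t.
Proof.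
by rewrite sum_geometric_weights mulr_gt0// subr_gt0 ltr_pdivlMr// mul1r.
Qed.

Let Xbar : X xbar. Proof. exact: (xbar_in run). Qed.

(** This is [gap_avg_le] divided by [(1 + s) / a ^+ k]: the weights satisfy
    [theta 1 * tau 1 = 1 + s] and [theta 1 * eta 1 = mu * (1 + s)]. *)
Lemma linear_gap_avg_le y gg : X y -> dual_dom f gg ->
  (1 - a ^+ k) * Q (xbar, gbar) (y, gg) <=
  a ^+ k * (mu * P0 y + bregman J (u 0%N) (g 0%N) gg).
Proof.
move=> Xy gd.
have := gap_avg_le run tau0 eta0 Lf_le alpha0 eta_le tauE th0 S0 k_gt0 Xy gd thE.
have kk : (1 <= 1 <= k)%N := k_gt0.
have [-> -> _] := params kk; rewrite thetaE// expr1 sum_geometric_weights.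
set V := Q _ _; set D := bregman J _ _ _ => H.
have : ((1 + s) / a ^+ k) * ((1 - a ^+ k) * V) <=
   ((1 + s) / a ^+ k) * (a ^+ k * (mu * P0 y + D)).
  have -> : ((1 + s) / a ^+ k) * ((1 - a ^+ k) * V) =
     (1 + s) * (1 / a ^+ k - 1) * V by field; rewrite gt_eqF.
  apply: le_trans H _; rewrite le_eqVlt; apply/orP; left; apply/eqP.
  rewrite -/P0 -[X in mu * X]a_s1 -[X in X * D]a_s1; field.
  by rewrite !gt_eqF.
by rewrite ler_pM2l// divr_gt0.
Qed.

(** Replaces [1 - a ^+ k] by a lower bound [p] free of [k]; this is monotone only for [V >= 0],
    hence the split on the sign. *)
Let gap_from_bound V B C p : 0 <= C -> 0 < p -> p <= 1 - a ^+ k ->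
  (1 - a ^+ k) * V <= a ^+ k * B -> B <= p * C -> V <= a ^+ k * C.
Proof.
move=> C0 p0 pk VB BC; have [V0|V0] := leP V 0.
  by apply: le_trans V0 _; rewrite mulr_ge0// ltW.
rewrite -(ler_pM2l p0) mulrCA; apply: le_trans (ler_wpM2l (ltW ak_gt0) BC).
by apply: le_trans VB; rewrite ler_wpM2r// ltW.
Qed.

Let c_ := mu * (1 + s) * q ^+ 2 * a ^+ k.

Let q_ge1 : 1 <= q. Proof. by rewrite qE lerDl divr_ge0 ?sqr_ge0. Qed.

Lemma linear_gap y gg : X y -> dual_dom f gg ->
  exists2 y', X y' & Q (xbar, gbar) (y, gg) <= c_ * P0 y'.
Proof.
move=> Xy gd.
(* The primal term involves [P0 y] and the dual one is bounded by [Lf * P0 xbar]; the larger of the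
   two distances serves for both. *)
suff [y' [Xy' le1 le2]] : exists y', [/\ X y', P0 y <= P0 y' & P0 xbar <= P0 y'].
  exists y' => //; apply: le_trans (gap_fun_le_grad _ _ _ gd) _.
  have [Gd _] := conj_fun_grad xbar.
  have -> : c_ * P0 y' = a ^+ k * (mu * (1 + s) * q ^+ 2 * P0 y').
    by rewrite /c_; ring.
  apply: (gap_from_bound (p := 1 - a) _ _ _ (linear_gap_avg_le Xy Gd)).
  - by rewrite mulr_ge0 ?P0_ge0// mulr_ge0 ?sqr_ge0// mulr_ge0// ltW.
  - by rewrite subr_gt0.
  - rewrite lerD2l lerN2; exact: (ler_wiXn2l a_ge0 (ltW a_lt1) k_gt0).
  - have D0 := dual_bregman0_le Xbar.
    have PN := ler_wpM2l Lf_ge0 (P0_ge Xbar).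
    have L1 := ler_wpM2l Lf_ge0 le2; have L2 := ler_wpM2l mu_ge0 le1.
    have : mu * q * P0 y' <= mu * q * P0 y' * q.
      by rewrite ler_peMr// mulr_ge0 ?P0_ge0// mulr_ge0// (le_trans _ q_ge1).
    have -> : (1 - a) * (mu * (1 + s) * q ^+ 2 * P0 y') =
        ((1 + s) - a * (1 + s)) * (mu * q * P0 y' * q) by ring.
    rewrite a_s1 mu_q; lra.
by have [le|/ltW le] := leP (P0 y) (P0 xbar); [exists xbar|exists y].
Qed.

(** Both legs of the path through [xs] are controlled: [x t] to [xs] by [linear_rate], [xs] to [x 0]
    by [P0_ge]. *)
Let norm_dist0_le t : (1 <= t <= k)%N ->
  N (x t - x 0%N) ^+ 2 <= 4 * (1 + q * a) * P0 xs.
Proof.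
move=> tk; have [Xt st] := run_primal run (andP tk).2.
have Pxs := P0_ge0 Xxs.
have H1 := linear_rate tk; have H2 := bregman_ge_sqr Xt Xxs st.
have H3 := P0_ge Xxs.
have : q * a ^+ t * P0 xs <= q * a * P0 xs.
  rewrite ler_wpM2r// ler_wpM2l ?(le_trans _ q_ge1)//.
  exact: (ler_wiXn2l a_ge0 (ltW a_lt1) (andP tk).1).
have := is_norm_triangle N_norm (x t - xs) (xs - x 0%N).
rewrite addrA subrK (is_norm_dist N_norm (x t) xs).
have := is_norm_ge0 N_norm (x t - x 0%N).
move: H1 H2 H3; set A := N (xs - x t); set B := N (xs - _); set E := N _.
move=> H1 H2 H3 E0 EAB H4.
have : E ^+ 2 <= (A + B) ^+ 2 by rewrite ler_sqr ?nnegrE ?addr_ge0 ?is_norm_ge0.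
have := sqr_ge0 (A - B); rewrite !expr2; lra.
Qed.

Let norm_sqr_conv y1 y2 (l : R) : X y1 -> X y2 -> 0 <= l <= 1 ->
  N (l *: y1 + (1 - l) *: y2 - x 0%N) ^+ 2 <=
  l * N (y1 - x 0%N) ^+ 2 + (1 - l) * N (y2 - x 0%N) ^+ 2.
Proof.
move=> _ _ /andP[l0 l1].
have -> : l *: y1 + (1 - l) *: y2 - x 0%N =
    l *: (y1 - x 0%N) + (1 - l) *: (y2 - x 0%N).
  by apply/rowP => i; rewrite !mxE; ring.
have := is_norm_triangle N_norm (l *: (y1 - x 0%N)) ((1 - l) *: (y2 - x 0%N)).
rewrite !(is_norm_scale N_norm) !ger0_norm ?subr_ge0//.
have := is_norm_ge0 N_norm (l *: (y1 - x 0%N) + (1 - l) *: (y2 - x 0%N)).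
set A := N (y1 - _); set B := N (y2 - _); set E := N _ => E0 EAB.
have : E ^+ 2 <= (l * A + (1 - l) * B) ^+ 2.
  by rewrite ler_sqr ?nnegrE ?addr_ge0 ?mulr_ge0 ?subr_ge0 ?is_norm_ge0.
(* This is the exact defect of convexity of the square at [A] and [B]. *)
have : 0 <= l * (1 - l) * (A - B) ^+ 2.
  by rewrite mulr_ge0 ?sqr_ge0// mulr_ge0 ?subr_ge0.
rewrite !expr2; lra.
Qed.

Let norm_xbar_le : N (xbar - x 0%N) ^+ 2 <= 4 * (1 + q * a) * P0 xs.
Proof.
have [|_ H] := jensen_weighted_avg (y := x) X_conv norm_sqr_conv th0 _ S0.
  by move=> t /andP[_ tk]; case: (run_primal run tk).
rewrite -(ler_pM2l S0); apply: le_trans H _.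
rewrite mulr_suml big_nat [leRHS]big_nat; apply: ler_sum => t.
by rewrite ltnS => tk; rewrite ler_wpM2l ?th0 ?norm_dist0_le.
Qed.

(* [N(x^0 - xs)^2] and [N(xs - x^t)^2] are combined by [(A + B)^2 <= 2 A^2 + 2 B^2];
   the factor 2 lost there is regained from [1 - a^k >= (1 - a) (1 + a)]. *)
Lemma linear_gap_star_many gg : (1 < k)%N -> dual_dom f gg ->
  Q (xbar, gbar) (xs, gg) <= c_ * P0 xs.
Proof.
move=> k1 gd; apply: le_trans (gap_fun_le_grad _ _ _ gd) _.
have [Gd _] := conj_fun_grad xbar.
have Pxs := P0_ge0 Xxs.
have -> : c_ * P0 xs = a ^+ k * (mu * (1 + s) * q ^+ 2 * P0 xs).
  by rewrite /c_; ring.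
apply: (gap_from_bound (p := 1 - a ^+ 2) _ _ _ (linear_gap_avg_le Xxs Gd)).
- by rewrite mulr_ge0// mulr_ge0 ?sqr_ge0// mulr_ge0// ltW.
- by rewrite subr_gt0 exprn_ilt1.
- rewrite lerD2l lerN2; exact: (ler_wiXn2l a_ge0 (ltW a_lt1) k1).
have D0 := dual_bregman0_le Xbar.
have PN := ler_wpM2l Lf_ge0 norm_xbar_le.
have -> : (1 - a ^+ 2) * (mu * (1 + s) * q ^+ 2 * P0 xs) =
    ((1 + s) - a * (1 + s)) * (1 + a) * q ^+ 2 * (mu * P0 xs) by ring.
rewrite a_s1 addrK mul1r.
have r0 : 0 <= s ^+ 2 / 2 by rewrite divr_ge0 ?sqr_ge0.
move: (s ^+ 2 / 2) r0 LfE qE => r r0 LfrE qrE.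
(* With [q = 1 + r] the two sides differ by exactly [(1 - a) * r ^+ 2 + a]. *)
have : 1 + 2 * r * (1 + q * a) <= (1 + a) * q ^+ 2.
  have : 0 <= (1 - a) * r ^+ 2 + a.
    by rewrite addr_ge0// mulr_ge0 ?sqr_ge0// subr_ge0 ltW.
  rewrite qrE; lra.
move=> /(ler_wpM2r (mulr_ge0 mu_ge0 Pxs)).
move: D0 PN; rewrite LfrE; lra.
Qed.

(* For [k = 1] nothing can be regained that way, but then [u 1 = u 0 = x 0], so
   the dual distances based at [g 0] and [g 1] coincide and cancel. *)
Lemma linear_gap_star_one gg : k = 1%N -> dual_dom f gg ->
  Q (xbar, gbar) (xs, gg) <= c_ * P0 xs.
Proof.
move=> k1 gd; have kk : (1 <= 1 <= k)%N := k_gt0.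
have Pxs := P0_ge0 Xxs.
have avgE (y : nat -> 'rV[R]_n) : weighted_avg k theta y = y 1%N.
  rewrite /weighted_avg k1 !big_nat1 scalerA mulVf ?scale1r// thetaE//.
  by rewrite expr1 mul1r invr_eq0 gt_eqF.
rewrite /xbar /gbar !avgE.
have [tE eE _] := params kk.
have sg0 := run_dual run tau0 (leq0n k); have sg1 := run_dual run tau0 k_gt0.
have [g1d J1] := conj_fun_subdiff sg1; have [_ J0] := conj_fun_subdiff sg0.
have u0E : u 0%N = x 0%N by case: run.
have u1E : u 1%N = u 0%N.
  case: run => _ _ _ _ /(_ 1%N k_gt0)[_ -> _ _ _] /=.
  rewrite tE subrr scaler0 add0r -u0E -{1}(scale1r (u 0%N)) -scalerDl scalerA.
  by rewrite mulVf ?scale1r// gt_eqF.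
case: run => _ _ _ _ /(_ 1%N k_gt0)[_ uE _ _ [h' sh /(_ xs Xxs) VI]].
have tau1 : 0 < 1 + tau 1%N by rewrite tE.
have := gap_step_le (x 0%N) (g 0%N) gg tau1 Xxs sh VI uE.
rewrite /= subrr scaler0 add0r tE eE -/P0.
have DE : bregman J (u 1%N) (g 1%N) gg = bregman J (u 0%N) (g 0%N) gg.
  by rewrite /bregman /J J1 J0 u1E !dotE; ring.
(* The dual distances add up to minus one copy, so the unscaled displacement cancels the coupling
   term and leaves [Lf / 2] times its squared norm. *)
rewrite DE; have := dual_bregman_ge (x 1%N - x 0%N) sg1 gd.
rewrite DE dotC.
have := dual_bregman_ge 0 sg0 g1d.
rewrite (is_norm0 N_norm) expr0n mulr0 dotC dot0l subrr => /(mulr_ge0 s_ge0) D01.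
have [X1 w1] := run_primal run k_gt0.
have P1 := le_trans (mulr_ge0 (sqr_ge0 _) _) (bregman_ge_sqr X1 Xxs w1).
have P1xs : 0 <= (mu + mu * s) * bregman omega (w 1%N) (x 1%N) xs.
  by rewrite mulr_ge0 ?P1 ?invr_ge0// addr_ge0// mulr_ge0.
have := ler_wpM2l (mulr_ge0 mu_ge0 s_ge0) (P0_ge X1).
have := norm_dist0_le kk.
set E2 := N _ ^+ 2 => HE HP HD HQ.
suff : mu * s * P0 xs + (Lf - mu * s) * (E2 / 2) <= c_ * P0 xs.
  move: HP HD HQ D01 P1xs; by rewrite -/P0; lra.
have -> : c_ * P0 xs = s * q ^+ 2 * (mu * P0 xs).
  by rewrite /c_ k1 expr1 -[in RHS]a_s1; ring.
have E0 : 0 <= E2 by exact: sqr_ge0.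
have M0 : 0 <= mu * P0 xs by rewrite mulr_ge0.
have [sle|/ltW sge] := leP s 2.
  have : 0 <= mu * (s * (2 - s)) * E2.
    by apply: mulr_ge0 => //; rewrite !mulr_ge0 ?subr_ge0.
  have : 0 <= (q ^+ 2 - 1) * (s * (mu * P0 xs)).
    by rewrite mulr_ge0 ?mulr_ge0// subr_ge0 exprn_ege1.
  rewrite LfE; lra.
have r0 : 0 <= s ^+ 2 / 2 by rewrite divr_ge0 ?sqr_ge0.
move: (s ^+ 2 / 2) r0 LfE qE => r r0 LfrE qrE.
(* For [s >= 2] it remains that [2 r (1 + q a) <= s (2 r + r^2)], which follows from [a <= 1] and
   [2 (2 r + r^2) = 2 r (1 + q)]. *)
have := ler_wpM2l Lf_ge0 HE.
have : 0 <= (1 - a) * q * (Lf * P0 xs).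
  apply: mulr_ge0 (mulr_ge0 Lf_ge0 Pxs).
  by apply: mulr_ge0; [rewrite subr_ge0 ltW|exact: le_trans q_ge1].
have : 0 <= (s - 2) * (2 * r + r ^+ 2) * (mu * P0 xs).
  apply: mulr_ge0 M0; rewrite mulr_ge0 ?subr_ge0//.
  by rewrite addr_ge0 ?sqr_ge0// mulr_ge0.
have : 0 <= mu * s * E2 by apply: mulr_ge0 => //; rewrite mulr_ge0.
rewrite qrE LfrE; lra.
Qed.

Lemma linear_gap_star gg : dual_dom f gg ->
  Q (xbar, gbar) (xs, gg) <= c_ * P0 xs.
Proof.
have [k1|k1] := leqP k 1; last exact: linear_gap_star_many.
by apply: linear_gap_star_one; apply/eqP; rewrite eqn_leq k1.
Qed.

Lemma linear_gap_bounds :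
  let zbar := (xbar, gbar) in
  let Psi := composite f h omega mu in
  let c := mu * (1 + s) * q ^+ 2 * a ^+ k in
  [/\ ((Psi xbar - Psi xs)%:E <= gap_star f h omega mu xs zbar)%E,
      (gap_star f h omega mu xs zbar <= (c * P0 xs)%:E)%E,
      ((Psi xbar - Psi xs)%:E <= gap X f h omega mu zbar)%E &
      (gap X f h omega mu zbar <=
        c%:E * ereal_sup [set (P0 y)%:E | y in X])%E].
Proof.
move=> zbar Psi c; apply: gap_bounds => //.
- exact: (gbar_in run).
- by rewrite mulr_ge0 ?exprn_ge0// mulr_ge0 ?sqr_ge0// mulr_ge0// ltW.
- exact: linear_gap_star.
- exact: linear_gap.
Qed.

End Gap.
End LinearRate.
End PDG.

(** * Both parameter choices for the composite problem *)

Theorem theorem1 (R : realType) (n m k : nat) (k_gt0 : (0 < k)%N)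
  (X : set 'rV[R]_n) (X_closed : closed X) (X_convex : convex_set X)
  (N : 'rV[R]_n -> R) (N_norm : is_norm N)
  (f_ : 'I_m -> 'rV[R]_n -> R) (L_ : 'I_m -> R)
  (f_convex : forall i, convex_function setT (f_ i))
  (f_diff : forall i x, differentiable (f_ i) x)
  (f_smooth : forall i x1 x2,
    (dual_norm N (grad (f_ i) x1 - grad (f_ i) x2)
       <= (L_ i * N (x1 - x2))%:E)%E)
  (f : 'rV[R]_n -> R) (f_def : forall x, f x = \sum_(i < m) f_ i x)
  (L : R) (L_def : L = \sum_(i < m) L_ i)
  (Lf : R) (Lf_ge0 : 0 <= Lf)
  (Lf_smooth : forall x1 x2,
    (dual_norm N (grad f x1 - grad f x2) <= (Lf * N (x1 - x2))%:E)%E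
    /\ Lf * N (x1 - x2) <= L * N (x1 - x2))
  (h : 'rV[R]_n -> R) (h_convex : convex_function X h)
  (omega : 'rV[R]_n -> R) (omega_sconvex : strongly_convex X N 1 omega)
  (mu : R) (mu_ge0 : 0 <= mu)
  (xs : 'rV[R]_n) (xs_opt : xs \in argmin X (composite f h omega mu))
  (tau eta alpha theta : nat -> R)
  (theta_ge0 : forall t, (1 <= t <= k)%N -> 0 <= theta t)
  (x g w u : nat -> 'rV[R]_n)
  (run : pdg_run X f h omega mu k tau eta alpha x g w u) :
  let Psi := composite f h omega mu in
  let P0 := bregman omega (w 0%N) (x 0%N) in
  let P0max := ereal_sup [set (P0 y)%:E | y in X] in
  let xbar := weighted_avg k theta x in
  let zbar := (xbar, weighted_avg k theta g) in
  (0 < mu ->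
   let a := Num.sqrt (2 * Lf / mu) / (1 + Num.sqrt (2 * Lf / mu)) in
   let c := mu * (1 - a)^-1 * (1 + Lf / mu * (2 + Lf / mu)) * a ^+ k in
   (forall t, (1 <= t <= k)%N ->
     [/\ tau t = Num.sqrt (2 * Lf / mu), eta t = Num.sqrt (2 * Lf * mu),
         alpha t = a & theta t = 1 / a ^+ t]) ->
   bregman omega (w k) (x k) xs <= (mu + Lf) / mu * a ^+ k * P0 xs
   (* For Lf = 0 one has a = 0 and the weights 1 / a ^+ t are undefined. *)
   /\ (0 < Lf ->
       [/\ ((Psi xbar - Psi xs)%:E <= gap_star f h omega mu xs zbar)%E,
           (gap_star f h omega mu xs zbar <= (c * P0 xs)%:E)%E,
           ((Psi xbar - Psi xs)%:E <= gap X f h omega mu zbar)%E &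
           (gap X f h omega mu zbar <= c%:E * P0max)%E]))
  /\
  (let c := 8 * Lf / (k%:R * (k%:R + 1)) in
   (forall t, (1 <= t <= k)%N ->
     [/\ tau t = (t%:R - 1) / 2, eta t = 4 * Lf / t%:R,
         alpha t = (t%:R - 1) / t%:R & theta t = t%:R]) ->
   [/\ ((Psi xbar - Psi xs)%:E <= gap_star f h omega mu xs zbar)%E,
       (gap_star f h omega mu xs zbar <= (c * P0 xs)%:E)%E,
       ((Psi xbar - Psi xs)%:E <= gap X f h omega mu zbar)%E &
       (gap X f h omega mu zbar <= c%:E * P0max)%E]).
Proof.
move=> Psi P0 P0max xbar zbar.
have Xc := convex_setE X_convex.
have hc := convex_functionE h_convex.
have fE : f = \sum_(i < m) f_ i by apply/funext => y; rewrite f_def fct_sumE.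
have fd y : differentiable f y.
  by rewrite fE; apply: differentiable_sum => i; exact: f_diff.
have fs y1 y2 := (Lf_smooth y1 y2).1.
have fc y1 y2 (l : R) : 0 <= l <= 1 ->
    f (l *: y1 + (1 - l) *: y2) <= l * f y1 + (1 - l) * f y2.
  move=> l01; rewrite !f_def !mulr_sumr -big_split; apply: ler_sum => i _.
  exact: convex_functionE (f_convex i) _ _ _ I I l01.
have Xxs : X xs by move: xs_opt; rewrite inE => -[].
have kk : (1 <= k <= k)%N by rewrite k_gt0 leqnn.
split.
  move=> mu_gt0; set s := Num.sqrt (2 * Lf / mu) => a c params.
  have s0 : 0 <= s by exact: sqrtr_ge0.
  have sE : s ^+ 2 = 2 * Lf / mu.
    by rewrite sqr_sqrtr// divr_ge0// mulr_ge0.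
  have LfE : Lf = mu * (s ^+ 2 / 2) by rewrite sE; field; rewrite gt_eqF.
  have muE : Num.sqrt (2 * Lf * mu) = mu * s.
    have -> : 2 * Lf * mu = (mu * s) ^+ 2 by rewrite LfE; field.
    by rewrite sqrtr_sqr ger0_norm// mulr_ge0.
  have params' t : (1 <= t <= k)%N ->
      [/\ tau t = s, eta t = mu * s & alpha t = s / (1 + s)].
    by move=> /params[-> -> -> _]; rewrite muE.
  have s1 : 1 + s != 0 by rewrite gt_eqF// ltr_wpDr.
  split.
    have -> : (mu + Lf) / mu = 1 + Lf / mu by field; rewrite gt_eqF.
    exact: (linear_rate Xc N_norm Lf_ge0 fd fs fc hc omega_sconvex mu_ge0
      run k_gt0 xs_opt mu_gt0 s0 LfE params' kk).
  move=> Lf_gt0.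
  have s_gt0 : 0 < s by rewrite sqrtr_gt0 divr_gt0// mulr_gt0.
  have thE t : (1 <= t <= k)%N -> theta t = 1 / (s / (1 + s)) ^+ t.
    by move=> /params[_ _ _ ->].
  have cE : c = mu * (1 + s) * (1 + Lf / mu) ^+ 2 * (s / (1 + s)) ^+ k.
    (* The constants agree because [(1 - a)^-1 = 1 + s] and the bracket is a perfect square. *)
    have -> : c = mu * (1 - a)^-1 * (1 + Lf / mu * (2 + Lf / mu)) * a ^+ k by [].
    have -> : 1 - a = (1 + s)^-1 by rewrite /a; field.
    by rewrite invrK -/a; ring.
  rewrite cE.
  exact: (linear_gap_bounds Xc N_norm Lf_ge0 fd fs fc hc omega_sconvex mu_ge0
    run k_gt0 xs_opt mu_gt0 s0 LfE params' s_gt0 thE).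
move=> c params.
exact: (sublinear_gap_bounds Xc N_norm Lf_ge0 fd fs fc hc omega_sconvex mu_ge0
  run k_gt0 params Xxs).
Qed.
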